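(* The exponential map $f\colon\mathbb{C}\to\mathbb{C}$, $z\mapsto e^z$, is chaotic in the sense of Devaney.
   Context: Let $X\subset\mathbb{C}$ be infinite and $f\colon X\to X$ continuous. Then $f$ is chaotic in the sense of Devaney if (a) the set of periodic points of $f$ (points $x$ with $f^n(x)=x$ for some $n\geq1$, where $f^n$ is the $n$-th iterate) is dense in $X$, and (b) $f$ is topologically transitive: for all open sets $U,V\subset\mathbb{C}$ that intersect $X$, there are $z\in U\cap X$ and $n\geq 0$ with $f^n(z)\in V$. *)

(* Defs.v *)
From Stdlib Require Import Reals List.
Open Scope R_scope.

(* The complex plane, z = (Re z, Im z). *)
Definition CC : Type := (R * R)%type.

Definition cdist (z w : CC) : R :=
  sqrt ((fst z - fst w) ^ 2 + (snd z - snd w) ^ 2).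

Definition copen (U : CC -> Prop) : Prop :=
  forall z, U z -> exists eps, 0 < eps /\ forall w, cdist z w < eps -> U w.

Definition cexp (z : CC) : CC :=
  (exp (fst z) * cos (snd z), exp (fst z) * sin (snd z)).

Definition iter (n : nat) (f : CC -> CC) (z : CC) : CC := Nat.iter n f z.

Definition infinite_set (X : CC -> Prop) : Prop :=
  ~ exists l : list CC, forall z, X z -> In z l.

Definition maps_into (X : CC -> Prop) (f : CC -> CC) : Prop :=
  forall z, X z -> X (f z).

Definition continuous_on (X : CC -> Prop) (f : CC -> CC) : Prop :=
  forall z, X z -> forall eps, 0 < eps ->
    exists delta, 0 < delta /\
      forall w, X w -> cdist z w < delta -> cdist (f z) (f w) < eps.

Definition periodic_point (f : CC -> CC) (x : CC) : Prop :=
  exists n : nat, (1 <= n)%nat /\ iter n f x = x.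

Definition periodic_dense (X : CC -> Prop) (f : CC -> CC) : Prop :=
  forall U, copen U -> (exists z, U z /\ X z) ->
    exists x, U x /\ X x /\ periodic_point f x.

Definition top_transitive (X : CC -> Prop) (f : CC -> CC) : Prop :=
  forall U V, copen U -> copen V ->
    (exists z, U z /\ X z) -> (exists z, V z /\ X z) ->
    exists z n, U z /\ X z /\ V (iter n f z).

(* Devaney chaos, including the standing assumptions
   (X infinite, f : X -> X continuous). *)
Definition devaney_chaotic (X : CC -> Prop) (f : CC -> CC) : Prop :=
  infinite_set X /\ maps_into X f /\ continuous_on X f /\
  periodic_dense X f /\ top_transitive X f.

(* Main.v *)
Require Import Defs.
From Stdlib Require Import Reals Lra Lia Classical.
From Coquelicot Require Import Coquelicot.
Open Scope R_scope.

(** Every branch of the logarithm maps a half-plane into a strip of that half-plane or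
    of its mirror image, and contracts the hyperbolic metric [|dz| / |Im z|], strictly
    so away from the real axis. Hence the images of a hyperbolic ball around [z] contain
    hyperbolic balls around the orbit of [z] whose radii do not shrink, and which grow by
    a fixed factor whenever the orbit is not close to the real axis. A non-real orbit
    cannot stay close to the axis, so eventually such a ball meets a line [Im = k pi],
    which is mapped into the real axis: points with an eventually real orbit are dense.
    A real orbit tends to infinity with derivative tending to infinity, so small discs
    around such a point are eventually blown up to discs [B(X, X/4)] with [X] large, and
    two more steps cover any given point [v <> 0]. All this is done with Lipschitz
    inverse branches; their constants tend to 0, so when [v] is chosen in the original
    disc the Banach fixed point theorem gives a periodic point. *)

(** * Modulus of the exponential and distances between its values *)

Lemma Cmod_sqr (z : C) : Cmod z ^ 2 = fst z ^ 2 + snd z ^ 2.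
Proof. unfold Cmod. rewrite pow2_sqrt; nra. Qed.

Lemma Cmod_le_sqr (z : C) (r : R) :
  0 <= r -> fst z ^ 2 + snd z ^ 2 <= r ^ 2 -> Cmod z <= r.
Proof.
  intros Hr H. rewrite <- Cmod_sqr in H. pose proof (Cmod_ge_0 z). nra.
Qed.

Lemma cexp_plus (z w : C) : cexp (z + w)%C = (cexp z * cexp w)%C.
Proof.
  destruct z as [x y], w as [u v]. unfold cexp, Cplus, Cmult; simpl.
  rewrite exp_plus, cos_plus, sin_plus. f_equal; ring.
Qed.

Lemma Cmod_cexp (z : C) : Cmod (cexp z) = exp (fst z).
Proof.
  pose proof (exp_pos (fst z)) as He. unfold Cmod, cexp; simpl fst; simpl snd.
  rewrite <- (sqrt_pow2 (exp (fst z))) at 3 by lra. f_equal.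
  pose proof (sin2_cos2 (snd z)) as H. unfold Rsqr in H. nra.
Qed.

Lemma sinh_ge (h : R) : 0 <= h -> 2 * h <= exp h - exp (- h).
Proof.
  intros [Hh | <-]; [| rewrite Ropp_0; lra].
  destruct (MVT_cor2 (fun t => exp t - exp (- t) - 2 * t)
    (fun t => exp t + exp (- t) - 2) 0 h Hh) as [c [Hc _]].
  - intros c _. apply is_derive_Reals. auto_derive; [trivial | ring].
  - cbv beta in Hc. rewrite Ropp_0 in Hc.
    assert (0 <= exp c + exp (- c) - 2).
    { pose proof (exp_pos c). rewrite exp_Ropp.
      replace (exp c + / exp c - 2) with ((exp c - 1) ^ 2 * / exp c) by (field; lra).
      pose proof (Rinv_0_lt_compat _ H).
      apply Rmult_le_pos; [apply pow2_ge_0 | lra]. }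
    nra.
Qed.

(** Taking [exp ((x + u) / 2)] out of both exponentials leaves |2 sinh h| >= 2 |h| for h = (x -
    u)/2. *)
Lemma exp_sub_sqr_ge (x u : R) :
  exp (x + u) * (x - u) ^ 2 <= (exp x - exp u) ^ 2.
Proof.
  set (h := (x - u) / 2). set (m := exp ((x + u) / 2)).
  assert (Hx : exp x = m * exp h)
    by (unfold m, h; rewrite <- exp_plus; f_equal; field).
  assert (Hu : exp u = m * exp (- h))
    by (unfold m, h; rewrite <- exp_plus; f_equal; field).
  assert (Hxu : exp (x + u) = m ^ 2)
    by (unfold m; simpl; rewrite Rmult_1_r, <- exp_plus; f_equal; field).
  rewrite Hx, Hu, Hxu. replace (x - u) with (2 * h) by (unfold h; field).
  assert ((2 * h) ^ 2 <= (exp h - exp (- h)) ^ 2).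
  { destruct (Rle_or_lt 0 h) as [H0 | H0].
    - pose proof (sinh_ge h H0). nra.
    - pose proof (sinh_ge (- h) ltac:(lra)) as H. rewrite Ropp_involutive in H. nra. }
  replace ((m * exp h - m * exp (- h)) ^ 2)
    with (m ^ 2 * (exp h - exp (- h)) ^ 2) by ring.
  apply Rmult_le_compat_l; nra.
Qed.

(** Law of cosines in polar coordinates, with [1 - cos t] rewritten as [2 * sin (t / 2) ^ 2]. *)
Lemma cexp_dist_sqr (z w : C) :
  Cmod (cexp z - cexp w)%C ^ 2 =
  (exp (fst z) - exp (fst w)) ^ 2
  + 4 * exp (fst z + fst w) * sin ((snd z - snd w) / 2) ^ 2.
Proof.
  rewrite Cmod_sqr. destruct z as [x y], w as [u v]. unfold cexp; simpl fst; simpl snd.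
  rewrite exp_plus.
  assert (H : 4 * sin ((y - v) / 2) ^ 2 = 2 - 2 * cos (y - v)).
  { replace (y - v) with (2 * ((y - v) / 2)) at 2 by field.
    rewrite cos_2a_sin. ring. }
  rewrite cos_minus in H.
  pose proof (sin2_cos2 y) as Hy. pose proof (sin2_cos2 v) as Hv. unfold Rsqr in *.
  transitivity (exp x ^ 2 * (sin y * sin y + cos y * cos y)
    + exp u ^ 2 * (sin v * sin v + cos v * cos v)
    - 2 * (exp x * exp u) * (cos y * cos v + sin y * sin v)); [ring |].
  rewrite Hy, Hv.
  transitivity ((exp x - exp u) ^ 2 +
     (exp x * exp u) * (4 * sin ((y - v) / 2) ^ 2)); [rewrite H; ring | ring].
Qed.

(** Source of the Lipschitz bounds for logarithms below, both hyperbolic and Euclidean. *)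
Lemma cexp_dist_sqr_ge (z w : C) :
  exp (fst z + fst w) * ((fst z - fst w) ^ 2 + 4 * sin ((snd z - snd w) / 2) ^ 2)
  <= Cmod (cexp z - cexp w)%C ^ 2.
Proof. rewrite cexp_dist_sqr. pose proof (exp_sub_sqr_ge (fst z) (fst w)). nra. Qed.

(** * Polar coordinates: preimages under the exponential *)

Lemma polar_upper (a b : R) : 0 < b ->
  exists x y, 0 < y < PI /\ cexp (x, y) = (a, b).
Proof.
  intros Hb. set (m := sqrt (a ^ 2 + b ^ 2)).
  assert (Hm2 : m ^ 2 = a ^ 2 + b ^ 2) by (apply pow2_sqrt; nra).
  assert (Hm : 0 < m) by (apply sqrt_lt_R0; nra).
  assert (Hq : (a / m) ^ 2 < 1).
  { replace ((a / m) ^ 2) with (a ^ 2 / m ^ 2) by (field; lra).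
    apply (Rmult_lt_reg_r (m ^ 2)); [nra |]. unfold Rdiv.
    rewrite Rmult_assoc, Rinv_l; nra. }
  assert (Hq' : -1 < a / m < 1) by (split; nra).
  exists (ln m), (acos (a / m)). split; [apply acos_bound_lt; lra |].
  unfold cexp; simpl fst; simpl snd. rewrite exp_ln by lra.
  rewrite cos_acos, sin_acos by lra. f_equal; [field; lra |].
  replace (1 - (a / m)²) with ((b / m) ^ 2).
  - rewrite sqrt_pow2; [field; lra |].
    apply Rlt_le, Rdiv_lt_0_compat; lra.
  - unfold Rsqr. apply (Rmult_eq_reg_r (m ^ 2)); [| nra].
    transitivity (b ^ 2); [field; lra |].
    transitivity (m ^ 2 - a ^ 2); [lra | field; lra].
Qed.

Lemma polar (v : C) : v <> 0%C ->
  exists z : C, cexp z = v /\ - PI <= snd z <= PI.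
Proof.
  destruct v as [a b]. intros Hv. pose proof PI_RGT_0.
  destruct (Rtotal_order b 0) as [Hb | [-> | Hb]].
  - destruct (polar_upper a (- b)) as [x [y [Hy E]]]; [lra |].
    exists (x, - y). simpl. split; [| lra].
    unfold cexp in *; simpl in *. rewrite cos_neg, sin_neg.
    injection E as E1 E2. f_equal; lra.
  - destruct (Rlt_or_le 0 a) as [Ha | Ha].
    + exists (ln a, 0). unfold cexp; simpl. rewrite cos_0, sin_0, exp_ln by lra.
      split; [f_equal; ring | lra].
    + assert (a <> 0) by (intros ->; apply Hv; reflexivity).
      exists (ln (- a), PI). unfold cexp; simpl. rewrite cos_PI, sin_PI, exp_ln by lra.
      split; [f_equal; ring | lra].
  - destruct (polar_upper a b) as [x [y [Hy E]]]; [lra |].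
    exists (x, y). simpl. split; [exact E | lra].
Qed.

(** * Contraction by the logarithm within the strip 0 < Im < PI *)

(* Quantitative form of the strict contraction of the logarithm for [|dz| / Im z]:
   with [P^2 = tan (y/2) / tan (v/2)] and [p^2 = y / v] it reads
   [(P - 1/P)^2 >= (k+1)/2 * (p - 1/p)^2], and [P >= p^k] because
   [ln (tan (s/2)) - k * ln s] is increasing. *)
Lemma sin_half_contraction (k v y : R) :
  1 <= k -> 0 < v < y -> y < PI ->
  (forall s, v <= s <= y -> k * sin s <= s) ->
  (k + 1) / 2 * (y - v) ^ 2 * (sin y * sin v)
  <= 4 * sin ((y - v) / 2) ^ 2 * (y * v).
Proof.
  intros Hk [Hv Hvy] Hy Hs.
  assert (Hpos : forall s, v <= s <= y -> 0 < sin (s / 2) /\ 0 < cos (s / 2)).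
  { intros s Hs'. split; [apply sin_gt_0 | apply cos_gt_0]; lra. }
  (* The derivative of ln (tan (s/2)) is 1 / sin s, so [k * sin s <= s] makes the derivative of this
     function nonnegative. *)
  destruct (MVT_cor2 (fun s => ln (sin (s / 2)) - ln (cos (s / 2)) - k * ln s)
    (fun s => / sin s - k / s) v y Hvy) as [c [Hc Hcb]].
  { intros c Hcb. apply is_derive_Reals. destruct (Hpos c Hcb) as [H1 H2].
    auto_derive; [repeat split; lra |].
    replace (sin c) with (2 * sin (c / 2) * cos (c / 2))
      by (rewrite <- sin_2a; f_equal; field).
    pose proof (sin2_cos2 (c / 2)) as H. unfold Rsqr in H.
    unfold Rdiv in *.
    transitivity ((sin (c * / 2) * sin (c * / 2) + cos (c * / 2) * cos (c * / 2))
       / (2 * sin (c * / 2) * cos (c * / 2)) - k / c); [field; lra |].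
    rewrite H. field. lra. }
  assert (Hd : 0 <= / sin c - k / c).
  { assert (0 < sin c) by (apply sin_gt_0; lra).
    replace (/ sin c - k / c) with ((c - k * sin c) / (sin c * c)) by (field; lra).
    apply Rdiv_le_0_compat; [pose proof (Hs c); lra | nra]. }
  destruct (Hpos v ltac:(lra)) as [Sv Cv]. destruct (Hpos y ltac:(lra)) as [Sy Cy].
  (* [exp s] is p and [exp A] is P; monotonicity becomes [k * s <= A]. *)
  set (s := (ln y - ln v) / 2).
  set (A := (ln (sin (y / 2)) - ln (cos (y / 2)) - (ln (sin (v / 2)) - ln (cos (v / 2)))) / 2).
  assert (HA : k * s <= A) by (unfold A, s; nra).
  assert (Hs0 : 0 < s) by (unfold s; pose proof (ln_increasing v y Hv Hvy); lra).
  assert (Hp2 : y = exp s ^ 2 * v).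
  { simpl. rewrite Rmult_1_r, <- exp_plus.
    replace (s + s) with (ln y + - ln v) by (unfold s; field).
    rewrite exp_plus, exp_Ropp, !exp_ln by lra. field. lra. }
  assert (HP2 : sin (y / 2) * cos (v / 2) = exp A ^ 2 * (sin (v / 2) * cos (y / 2))).
  { simpl. rewrite Rmult_1_r, <- exp_plus.
    replace (A + A) with (ln (sin (y / 2)) + - ln (cos (y / 2))
      + (- ln (sin (v / 2)) + ln (cos (v / 2)))) by (unfold A; field).
    rewrite !exp_plus, !exp_Ropp, !exp_ln by lra. field. lra. }
  (* Since [A >= k * s >= s], replacing [s] by [A] gains at least [(k - 1) * s * exp s], which by
     [E3] is at least (k-1)/2 times [exp s - exp (- s)]. *)
  assert (Hgrow : (k + 1) / 2 * (exp s - exp (- s)) <= exp A - exp (- A)).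
  { assert (E1 : exp s * (1 + (k - 1) * s) <= exp A).
    { apply Rle_trans with (exp (s + (k - 1) * s)).
      - rewrite exp_plus. pose proof (exp_pos s).
        pose proof (exp_ineq1_le ((k - 1) * s)). nra.
      - destruct (Rle_lt_or_eq_dec (s + (k - 1) * s) A) as [H | H]; [lra | |].
        + left; apply exp_increasing; lra.
        + rewrite H; lra. }
    assert (E2 : exp (- A) <= exp (- s)).
    { destruct (Rle_lt_or_eq_dec (- A) (- s)) as [H | H]; [nra | |].
      - left; apply exp_increasing; lra.
      - rewrite H; lra. }
    assert (E3 : exp s - exp (- s) <= 2 * s * exp s).
    { pose proof (exp_ineq1_le (- (2 * s))). pose proof (exp_pos s).
      replace (- s) with (s + - (2 * s)) by ring. rewrite exp_plus. nra. }
    nra. }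
  assert (Hge : 0 <= exp s - exp (- s)) by (pose proof (sinh_ge s); lra).
  (* [L1] and [L2] turn both sides into multiples of the common factor
     [(y * v) * (sin y * sin v)]. *)
  assert (L1 : (y - v) ^ 2 = (exp s - exp (- s)) ^ 2 * (y * v)).
  { pose proof (exp_pos s). rewrite exp_Ropp, Hp2. field. lra. }
  assert (L2 : 4 * sin ((y - v) / 2) ^ 2 = (exp A - exp (- A)) ^ 2 * (sin y * sin v)).
  { pose proof (exp_pos A).
    replace (sin y) with (2 * sin (y / 2) * cos (y / 2))
      by (rewrite <- sin_2a; f_equal; field).
    replace (sin v) with (2 * sin (v / 2) * cos (v / 2))
      by (rewrite <- sin_2a; f_equal; field).
    replace ((y - v) / 2) with (y / 2 - v / 2) by field.
    rewrite sin_minus, HP2, exp_Ropp.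
    transitivity ((exp A - / exp A) ^ 2 * 4 * (sin (v / 2) * cos (y / 2))
      * (sin (y / 2) * cos (v / 2))); [rewrite HP2; field; lra | ring]. }
  rewrite L1, L2.
  assert (0 < sin y) by (apply sin_gt_0; lra).
  assert (0 < sin v) by (apply sin_gt_0; lra).
  assert (0 <= (y * v) * (sin y * sin v)) by (repeat apply Rmult_le_pos; lra).
  assert ((k + 1) / 2 * (exp s - exp (- s)) ^ 2 <= (exp A - exp (- A)) ^ 2).
  { set (d := exp s - exp (- s)) in *. set (D := exp A - exp (- A)) in *.
    apply Rle_trans with (((k + 1) / 2 * d) ^ 2).
    - assert (0 <= (k - 1) * (k + 1) * d ^ 2)
        by (repeat apply Rmult_le_pos; try lra; nra). nra.
    - assert (0 <= (k + 1) / 2 * d) by (apply Rmult_le_pos; lra). nra. }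
  nra.
Qed.

(** Taylor bounds of orders 3 and 5. On [[0, 4]], which contains [[0, PI]], y^5/120 <= 16 y^3/120,
    and 1/6 - 16/120 = 1/30. *)
Lemma sin_cubic_bounds (y : R) : 0 <= y <= 4 -> y - y ^ 3 / 6 <= sin y <= y - y ^ 3 / 30.
Proof.
  intros Hy. destruct (pre_sin_bound y 0 ltac:(lra) ltac:(lra)) as [L H].
  unfold sin_approx, sin_term in L, H. simpl in L, H.
  assert (0 <= y ^ 3) by (apply pow_le; lra).
  assert (y ^ 3 * y ^ 2 <= y ^ 3 * 16) by (apply Rmult_le_compat_l; nra).
  split; nra.
Qed.

Lemma sin_le_id (y : R) : 0 <= y <= 4 -> sin y <= y.
Proof.
  intros Hy. pose proof (sin_cubic_bounds y Hy).
  assert (0 <= y ^ 3) by (apply pow_le; lra). lra.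
Qed.

Lemma sin_sqr_le (t : R) : Rabs t <= 1 -> sin t ^ 2 <= t ^ 2.
Proof.
  intros Ht. apply Rabs_le_between in Ht. pose proof PI2_1.
  destruct (Rle_or_lt 0 t) as [H0 | H0].
  - pose proof (sin_le_id t ltac:(lra)).
    pose proof (sin_ge_0 t ltac:(lra) ltac:(lra)). nra.
  - pose proof (sin_le_id (- t) ltac:(lra)) as H1.
    pose proof (sin_ge_0 (- t) ltac:(lra) ltac:(lra)) as H2.
    rewrite sin_neg in H1, H2. nra.
Qed.

(** Combined with [cexp_dist_sqr_ge], this says that |z - w|^2 / (Im z Im w) is smaller, by the
    factor (k+1)/2 at least, than the same quotient for the images. The horizontal part uses
    [k * sin s <= s] at both points, the vertical part [sin_half_contraction]. *)
Lemma strip_contraction (k e a y v : R) :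
  1 <= k -> (forall s, e <= s < PI -> k * sin s <= s) ->
  0 < y < PI -> 0 < v < PI -> e <= y -> e <= v ->
  (k + 1) / 2 * (a ^ 2 + (y - v) ^ 2) * (sin y * sin v)
  <= (a ^ 2 + 4 * sin ((y - v) / 2) ^ 2) * (y * v).
Proof.
  intros Hk Hs Hy Hv Hey Hev.
  assert (0 < sin y) by (apply sin_gt_0; lra).
  assert (0 < sin v) by (apply sin_gt_0; lra).
  assert (Ha : (k + 1) / 2 * (sin y * sin v) <= y * v).
  { pose proof (Hs y ltac:(lra)). pose proof (Hs v ltac:(lra)).
    assert (H3 : (k * sin y) * (k * sin v) <= y * v)
      by (apply Rmult_le_compat; try lra; apply Rmult_le_pos; lra).
    assert (0 < sin y * sin v) by nra.
    assert ((k + 1) / 2 * (sin y * sin v) <= k * k * (sin y * sin v))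
      by (apply Rmult_le_compat_r; nra).
    lra. }
  assert (Hb : (k + 1) / 2 * (y - v) ^ 2 * (sin y * sin v)
    <= 4 * sin ((y - v) / 2) ^ 2 * (y * v)).
  { destruct (Rtotal_order v y) as [H1 | [-> | H1]].
    - apply sin_half_contraction; try lra. intros s Hs'; apply Hs; lra.
    - pose proof (pow2_ge_0 (sin ((y - y) / 2))). nra.
    - pose proof (sin_half_contraction k y v Hk ltac:(lra) ltac:(lra)) as H2.
      replace ((y - v) / 2) with (- ((v - y) / 2)) by field.
      rewrite sin_neg.
      assert (forall s, y <= s <= v -> k * sin s <= s) by (intros s Hs'; apply Hs; lra).
      specialize (H2 H3). nra. }
  assert (0 <= a ^ 2) by nra. nra.
Qed.

(** * Hyperbolic balls and branches of the logarithm *)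

(* For [q = 4 * sinh (d/2) ^ 2] this is the closed hyperbolic ball of radius [d]
   around [z] in the half-plane of [z]. *)
Definition hyp_near (q : R) (z w : C) : Prop :=
  0 < snd z * snd w /\ Cmod (z - w)%C ^ 2 <= q * (snd z * snd w).

(** The sign [s] is (-1)^k; the shift reduces every strip to the one next to the real axis. *)
Lemma trig_shift (k : nat) : exists s : R, s * s = 1 /\
  forall t, sin (t + INR k * PI) = s * sin t /\ cos (t + INR k * PI) = s * cos t.
Proof.
  induction k as [| k [s [Hs IH]]].
  - exists 1. split; [ring |]. intros t.
    replace (t + INR 0 * PI) with t by (simpl; ring). lra.
  - exists (- s). split; [lra |]. intros t. rewrite S_INR.
    replace (t + (INR k + 1) * PI) with ((t + INR k * PI) + PI) by ring.
    rewrite neg_sin, neg_cos. destruct (IH t) as [-> ->]. lra.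
Qed.

(* Any constant slightly above 1 works; this one is [(k+1)/2] for [k = 1 + e^2/30],
   where [e = 1/200] bounds from below the imaginary part of every point that is
   [hyp_near 32] to a point with imaginary part at least [1/4]. *)
Definition gain : R := 1 + / 2400000.

(** The branch takes values in the strip of height PI that contains [z]. Once this strip is moved
    down by [c = k * PI], [strip_contraction] applies; moving back up only enlarges the product of
    imaginary parts. The point [w] is chosen before [q], so both conclusions concern the same
    preimage. *)
Lemma log_branch_pos (z W : C) : 0 < snd z -> 0 < snd (cexp z) * snd W ->
  exists w : C, cexp w = W /\ forall q, hyp_near q (cexp z) W ->
    hyp_near q z w /\ (1 / 4 <= snd z -> q <= 32 -> hyp_near (q / gain) z w).
Proof.
  destruct z as [x y], W as [A B]. intros Hy HB. simpl in Hy.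
  pose proof PI_RGT_0 as HPI. pose proof PI_4 as HPI4.
  destruct (nfloor_ex (y / PI)) as [k Hk]; [apply Rdiv_le_0_compat; lra |].
  destruct (trig_shift k) as [s [Hs2 Hs]].
  set (c := INR k * PI) in *.
  set (y0 := y - c).
  assert (Hy0 : 0 <= y0 < PI).
  { unfold y0, c. replace y with (y / PI * PI) by (field; lra). nra. }
  assert (Hyc : y = y0 + c) by (unfold y0; ring).
  unfold cexp in HB; simpl in HB. rewrite Hyc in HB.
  destruct (Hs y0) as [Hsin _]. rewrite Hsin in HB.
  assert (Hy0' : 0 < y0).
  { destruct Hy0 as [[H | H] _]; [exact H |]. rewrite <- H, sin_0 in HB. lra. }
  assert (0 < sin y0) by (apply sin_gt_0; lra).
  assert (HsB : 0 < s * B).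
  { assert (0 < exp x * sin y0) by (apply Rmult_lt_0_compat; [apply exp_pos | lra]).
    nra. }
  destruct (polar_upper (s * A) (s * B) HsB) as [u [v0 [Hv0 Hw]]].
  exists (u, v0 + c).
  assert (Hcw : cexp (u, v0 + c) = (A, B)).
  { unfold cexp in *; simpl in *. destruct (Hs v0) as [-> ->].
    injection Hw as H1 H2.
    f_equal; [transitivity (s * (exp u * cos v0)); [ring | rewrite H1]
             |transitivity (s * (exp u * sin v0)); [ring | rewrite H2]];
      rewrite <- Rmult_assoc, Hs2; ring. }
  split; [exact Hcw |]. intros q [_ Hq]. rewrite <- Hcw in Hq.
  pose proof (cexp_dist_sqr_ge (x, y) (u, v0 + c)) as Hge.
  set (E := Cmod (cexp (x, y) - cexp (u, (v0 + c)%R))%C ^ 2) in *.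
  unfold hyp_near. rewrite Cmod_sqr. unfold cexp in Hq.
  simpl fst in *. simpl snd in *.
  rewrite Hyc in Hq, Hge |- *. rewrite Hsin in Hq. destruct (Hs v0) as [Hsin' _].
  rewrite Hsin' in Hq.
  replace (y0 + c - (v0 + c)) with (y0 - v0) in Hge by ring.
  replace (x + - u) with (x - u) by ring.
  replace (y0 + c + - (v0 + c)) with (y0 - v0) by ring.
  assert (0 < sin v0) by (apply sin_gt_0; lra).
  set (T := exp (x + u) * (sin y0 * sin v0)).
  assert (HT : 0 < T)
    by (unfold T; repeat apply Rmult_lt_0_compat; try lra; apply exp_pos).
  assert (Hq' : E <= q * T).
  { replace (q * T) with (q * (exp x * (s * sin y0) * (exp u * (s * sin v0)))); [lra |].
    unfold T. rewrite exp_plus.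
    transitivity (q * (exp x * exp u) * (s * s) * (sin y0 * sin v0)); [ring |].
    rewrite Hs2. ring. }
  assert (Hc : 0 <= c) by (unfold c; pose proof (pos_INR k); nra).
  assert (Hq0 : 0 <= q).
  { assert (0 <= E) by apply pow2_ge_0. nra. }
  assert (Hmain : forall kk e, 1 <= kk -> (forall s, e <= s < PI -> kk * sin s <= s) ->
    e <= y0 -> e <= v0 ->
    (kk + 1) / 2 * ((x - u) ^ 2 + (y0 - v0) ^ 2) <= q * (y0 * v0)).
  { intros kk e Hkk He H1 H2.
    pose proof (strip_contraction kk e (x - u) y0 v0 Hkk He ltac:(lra) Hv0 H1 H2) as H3.
    apply (Rmult_le_reg_r T); [exact HT |].
    apply Rle_trans with (E * (y0 * v0)).
    - apply Rle_trans with (exp (x + u) * ((x - u) ^ 2 + 4 * sin ((y0 - v0) / 2) ^ 2)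
        * (y0 * v0)).
      + unfold T. pose proof (exp_pos (x + u)). nra.
      + apply Rmult_le_compat_r; [nra | exact Hge].
    - assert (0 <= y0 * v0) by nra. nra. }
  pose proof (Hmain 1 0 ltac:(lra)
    ltac:(intros t Ht; pose proof (sin_le_id t); lra) ltac:(lra) ltac:(lra)) as Hweak.
  assert (Hprod : y0 * v0 <= (y0 + c) * (v0 + c)) by nra.
  assert (q * (y0 * v0) <= q * ((y0 + c) * (v0 + c)))
    by (apply Rmult_le_compat_l; assumption).
  assert (Hpos : 0 < (y0 + c) * (v0 + c)) by (apply Rmult_lt_0_compat; lra).
  split; [split; lra |].
  intros H14 Hq32. split; [exact Hpos |].
  assert (Hgain : 0 < gain) by (unfold gain; lra).
  apply (Rmult_le_reg_l gain); [exact Hgain |].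
  replace (gain * (q / gain * ((y0 + c) * (v0 + c)))) with (q * ((y0 + c) * (v0 + c)))
    by (field; lra).
  destruct k as [| k].
  - assert (Hc0 : c = 0) by (unfold c; simpl; ring). rewrite Hc0 in *.
    (* (y0 - v0)^2 <= 32 y0 v0 forces y0 <= 34 v0, hence v0 >= 1/136 when y0 >= 1/4. *)
    assert (Hv : 1 / 200 <= v0).
    { apply Rnot_lt_le. intros Hlt.
      assert (q * (y0 * v0) <= 32 * (y0 * v0)) by (apply Rmult_le_compat_r; nra).
      pose proof (pow2_ge_0 (x - u)).
      assert (Hd : (y0 - v0) ^ 2 <= 32 * (y0 * v0)) by lra.
      assert (y0 * (y0 - 34 * v0) <= 0) by nra. nra. }
    replace (y0 + 0) with y0 by ring. replace (v0 + 0) with v0 by ring.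
    (* For t >= 1/200, t^3/30 >= t/1200000, so sin t <= (1 - d) t with d = 1/1200000, and (1 + d)(1
       - d) <= 1. *)
    apply Rle_trans with (2 := Hmain (1 + / 1200000) (1 / 200) ltac:(lra)
      ltac:(intros t Ht; pose proof (sin_cubic_bounds t ltac:(lra));
        assert (t ^ 3 >= t * / 40000) by nra; nra) ltac:(lra) Hv).
    unfold gain. apply Req_le. field.
  (* In the higher strips the shift itself provides the gain: it at least doubles the product of
     imaginary parts, because [y0 < PI <= c]. *)
  - assert (Hc1 : PI <= c).
    { unfold c. rewrite S_INR. pose proof (pos_INR k). nra. }
    assert (y0 * v0 <= c * v0) by (apply Rmult_le_compat_r; lra).
    assert (0 <= c * (y0 + c)) by (apply Rmult_le_pos; lra).
    set (D := (x - u) ^ 2 + (y0 - v0) ^ 2) in *.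
    assert (0 <= D) by (apply Rplus_le_le_0_compat; apply pow2_ge_0).
    assert (gain * D <= 2 * D)
      by (apply Rmult_le_compat_r; [assumption | unfold gain; lra]).
    assert (q * (2 * (y0 * v0)) <= q * ((y0 + c) * (v0 + c)))
      by (apply Rmult_le_compat_l; lra).
    lra.
Qed.

Lemma cexp_conj (z : C) : cexp (Cconj z) = Cconj (cexp z).
Proof.
  unfold cexp, Cconj; simpl. rewrite cos_neg, sin_neg. f_equal. ring.
Qed.

Lemma hyp_near_conj (q : R) (z w : C) :
  hyp_near q z w -> hyp_near q (Cconj z) (Cconj w).
Proof.
  unfold hyp_near. rewrite !Cmod_sqr. destruct z, w; simpl.
  intros [H1 H2]. split; nra.
Qed.

Lemma log_branch (z W : C) : snd z <> 0 -> 0 < snd (cexp z) * snd W ->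
  exists w : C, cexp w = W /\ forall q, hyp_near q (cexp z) W ->
    hyp_near q z w /\ (1 / 4 <= Rabs (snd z) -> q <= 32 -> hyp_near (q / gain) z w).
Proof.
  intros Hz HW. destruct (Rlt_or_le 0 (snd z)) as [Hp | Hn].
  - rewrite Rabs_pos_eq by lra. apply log_branch_pos; assumption.
  - rewrite Rabs_left by lra.
    destruct (log_branch_pos (Cconj z) (Cconj W)) as [w [Hw H]].
    + simpl. lra.
    + rewrite cexp_conj. simpl. simpl in HW. lra.
    + exists (Cconj w). rewrite cexp_conj, Hw, Cconj_conj. split; [reflexivity |].
      intros q Hq. apply hyp_near_conj in Hq. rewrite <- cexp_conj in Hq.
      destruct (H q Hq) as [H1 H2]. rewrite <- (Cconj_conj z).
      split; [apply hyp_near_conj; exact H1 |].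
      simpl. rewrite Ropp_involutive.
      intros H3 H4. apply hyp_near_conj, H2; [simpl; lra | exact H4].
Qed.

Lemma hyp_near_dist (e : R) (z : C) : 0 < e -> snd z <> 0 ->
  exists q, 0 < q /\ forall w, hyp_near q z w -> cdist z w < e.
Proof.
  intros He Hz. set (y := Rabs (snd z)).
  assert (Hy : 0 < y) by (apply Rabs_pos_lt; exact Hz).
  (* With d = |z - w|, the product of imaginary parts is at most y (y + d), and d >= e would give
     e^2 y (y + d) <= d^2 (y + e)^2; the factor 2 makes this contradictory. *)
  exists (e ^ 2 / (2 * (y + e) ^ 2)). split; [apply Rdiv_lt_0_compat; nra |].
  intros w [Hw Hd]. change (cdist z w) with (Cmod (z - w)%C).
  apply Rnot_le_lt. intros Hge. set (d := Cmod (z - w)%C) in *.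
  assert (Hv : snd z * snd w <= y * (y + d)).
  { assert (Hs : Rabs (snd w) <= y + d).
    { replace (snd w) with (snd z - snd (z - w)%C) by (simpl; ring).
      eapply Rle_trans; [apply Rabs_triang |]. rewrite Rabs_Ropp.
      apply Rplus_le_compat_l.
      eapply Rle_trans; [| apply Rmax_Cmod]. apply Rmax_r. }
    eapply Rle_trans; [apply Rle_abs |]. rewrite Rabs_mult.
    apply Rmult_le_compat_l; [lra | exact Hs]. }
  assert (Hd2 : d ^ 2 * (2 * (y + e) ^ 2) <= e ^ 2 * (y * (y + d))).
  { apply Rle_trans with (e ^ 2 * (snd z * snd w)).
    - replace (e ^ 2 * (snd z * snd w)) with
        (e ^ 2 / (2 * (y + e) ^ 2) * (snd z * snd w) * (2 * (y + e) ^ 2))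
        by (field; lra).
      apply Rmult_le_compat_r; [nra | exact Hd].
    - apply Rmult_le_compat_l; [nra | exact Hv]. }
  assert (E1 : e ^ 2 * (y * (y + d)) <= d ^ 2 * (y + e) ^ 2).
  { replace (e ^ 2 * (y * (y + d))) with ((e * y) * (e * (y + d))) by ring.
    replace (d ^ 2 * (y + e) ^ 2) with ((d * (y + e)) * (d * (y + e))) by ring.
    apply Rmult_le_compat; nra. }
  assert (0 < d ^ 2 * (y + e) ^ 2) by (apply Rmult_lt_0_compat; nra).
  lra.
Qed.

Lemma hyp_near_mono (q q' : R) (z w : C) : q <= q' -> hyp_near q z w -> hyp_near q' z w.
Proof. intros Hq [H1 H2]. split; [exact H1 | nra]. Qed.

(** * Non-real orbits, and density of the eventually real ones *)

Lemma iter_S (n : nat) (z : CC) : iter (S n) cexp z = cexp (iter n cexp z).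
Proof. reflexivity. Qed.

Lemma iter_plus (n m : nat) (z : CC) :
  iter (n + m) cexp z = iter n cexp (iter m cexp z).
Proof. apply Nat.iter_add. Qed.

Lemma real_part_step (x y : R) : Rabs y < 1 / 4 -> 0 <= x ->
  x + 9 / 10 <= exp x * cos y.
Proof.
  intros Hy Hx. apply Rabs_def2 in Hy.
  assert (Hc : 24 / 25 <= cos y).
  { replace y with (2 * (y / 2)) by field. rewrite cos_2a_sin.
    assert (H : sin (y / 2) ^ 2 <= (y / 2) ^ 2)
      by (apply sin_sqr_le, Rabs_le; lra).
    nra. }
  (* The quadratic term outweighs the loss from the factor 24/25 when [x] is large. *)
  assert (He : 1 + x + x ^ 2 / 4 <= exp x).
  { replace x with (x / 2 + x / 2) at 3 by field. rewrite exp_plus.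
    pose proof (exp_ineq1_le (x / 2)). nra. }
  assert (exp x * (24 / 25) <= exp x * cos y)
    by (apply Rmult_le_compat_l; [left; apply exp_pos | exact Hc]).
  nra.
Qed.

Lemma imag_part_step (x y : R) : Rabs y < 1 / 4 -> 1 <= x ->
  3 / 2 * Rabs y <= Rabs (exp x * sin y).
Proof.
  intros Hy Hx. rewrite Rabs_mult, (Rabs_pos_eq (exp x)) by (left; apply exp_pos).
  assert (Hs : 9 / 10 * Rabs y <= Rabs (sin y)).
  { destruct (Rle_or_lt 0 y) as [H0 | H0].
    - rewrite (Rabs_pos_eq y) in * by lra.
      pose proof (sin_cubic_bounds y ltac:(lra)).
      eapply Rle_trans; [| apply Rle_abs].
      assert (y ^ 3 <= y * / 16) by nra. lra.
    - rewrite (Rabs_left y) in * by lra.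
      pose proof (sin_cubic_bounds (- y) ltac:(lra)).
      rewrite <- (Rabs_Ropp (sin y)), <- sin_neg.
      eapply Rle_trans; [| apply Rle_abs].
      assert ((- y) ^ 3 <= - y * / 16) by nra. lra. }
  pose proof (exp_ineq1_le x). pose proof (Rabs_pos y).
  apply Rle_trans with (2 * (9 / 10 * Rabs y)); [lra |].
  apply Rmult_le_compat; lra.
Qed.

Lemma geometric_unbounded (a r b : R) : 0 < a -> 1 < r ->
  exists n, b < a * r ^ n.
Proof.
  intros Ha Hr. destruct (Pow_x_infinity r) with (b := (Rabs b + 1) / a) as [N HN].
  - rewrite Rabs_pos_eq; lra.
  - exists N. specialize (HN N (le_n N)).
    rewrite Rabs_pos_eq in HN by (apply pow_le; lra).
    pose proof (Rle_abs b).
    apply Rlt_le_trans with (a * ((Rabs b + 1) / a)).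
    + replace (a * ((Rabs b + 1) / a)) with (Rabs b + 1) by (field; lra). lra.
    + apply Rmult_le_compat_l; lra.
Qed.

(* Close to the real axis the orbit follows [x -> exp x] to infinity, which in turn
   expands the imaginary parts. *)
Lemma nonreal_orbit_leaves_axis (z : CC) :
  (forall n, snd (iter n cexp z) <> 0) ->
  forall N, exists n, (N <= n)%nat /\ 1 / 4 <= Rabs (snd (iter n cexp z)).
Proof.
  intros Hz N. apply NNPP. intros Hno.
  set (o := fun n => iter n cexp z).
  assert (Hsmall : forall n, (N <= n)%nat -> Rabs (snd (o n)) < 1 / 4).
  { intros n Hn. apply Rnot_le_lt. intros H. apply Hno. exists n. auto. }
  (* Counting starts at [S N]: the small imaginary part at time [N] has positive cosine, so the next
     real part is nonnegative. *)
  assert (Hx : forall m, 9 / 10 * INR m <= fst (o (S N + m)%nat)).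
  { induction m as [| m IH].
    - rewrite Nat.add_0_r. unfold o. rewrite iter_S. simpl.
      pose proof (Rabs_def2 _ _ (Hsmall N (le_n N))). unfold o in H.
      rewrite Rmult_0_r. apply Rmult_le_pos; [left; apply exp_pos |].
      apply cos_ge_0; pose proof PI2_1; lra.
    - rewrite S_INR, Nat.add_succ_r. change (o (S (S N + m))) with (cexp (o (S N + m)%nat)).
      pose proof (real_part_step (fst (o (S N + m)%nat)) (snd (o (S N + m)%nat))
        ltac:(apply Hsmall; lia) ltac:(pose proof (pos_INR m); lra)).
      unfold cexp; cbn [fst]. lra. }
  (* Two more steps bring the real part to 9/5 >= 1, as [imag_part_step] requires. *)
  set (M := (S N + 2)%nat).
  assert (Hy : forall m, Rabs (snd (o M)) * (3 / 2) ^ m <= Rabs (snd (o (M + m)%nat))).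
  { induction m as [| m IH].
    - rewrite Nat.add_0_r. simpl. lra.
    - rewrite Nat.add_succ_r. change (o (S (M + m))) with (cexp (o (M + m)%nat)).
      assert (H1 : 1 <= fst (o (M + m)%nat)).
      { unfold M. rewrite <- Nat.add_assoc. pose proof (Hx (2 + m)%nat) as H.
        rewrite plus_INR in H. simpl (INR 2) in H. pose proof (pos_INR m). lra. }
      pose proof (imag_part_step (fst (o (M + m)%nat)) (snd (o (M + m)%nat))
        ltac:(apply Hsmall; unfold M; lia) H1).
      unfold cexp; cbn [snd]. simpl pow. lra. }
  destruct (geometric_unbounded (Rabs (snd (o M))) (3 / 2) 1) as [m Hm].
  - apply Rabs_pos_lt, Hz.
  - lra.
  - pose proof (Hy m). pose proof (Hsmall (M + m)%nat ltac:(unfold M; lia)). lra.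
Qed.

(** Move vertically away from the axis to the next line Im = k PI, at distance at most PI. The
    constant 16 suffices: in absolute value the imaginary parts are at least 1/4 and PI, and PI^2 <=
    16 (1/4) PI. *)
Lemma real_preimage_near (z : C) : 1 / 4 <= Rabs (snd z) ->
  exists w, hyp_near 16 z w /\ snd (cexp w) = 0.
Proof.
  assert (Hpos : forall z : C, 1 / 4 <= snd z ->
    exists w, hyp_near 16 z w /\ snd (cexp w) = 0).
  { intros [x y] Hy. simpl in Hy.
    pose proof PI_RGT_0. pose proof PI_4.
    destruct (archimed (y / PI)) as [H1 H2]. set (k := up (y / PI)) in *.
    assert (E : y / PI * PI = y) by (field; lra).
    assert (y < IZR k * PI) by nra.
    assert (IZR k * PI <= y + PI) by nra.
    assert (PI <= IZR k * PI).
    { assert (0 < k)%Z.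
      { apply lt_IZR. assert (0 <= y / PI) by (apply Rdiv_le_0_compat; lra). lra. }
      assert (1 <= IZR k) by (apply IZR_le; lia). nra. }
    exists (x, IZR k * PI). split.
    - unfold hyp_near. rewrite Cmod_sqr. simpl fst; simpl snd. split; [nra |].
      assert (PI * PI <= 16 * (y * (IZR k * PI))) by nra. nra.
    - simpl. rewrite (sin_eq_0_1 (IZR k * PI)); [ring | exists k; reflexivity]. }
  intros Hz. destruct (Rle_or_lt 0 (snd z)) as [H0 | H0].
  - rewrite Rabs_pos_eq in Hz by lra. apply Hpos, Hz.
  - rewrite Rabs_left in Hz by lra.
    destruct (Hpos (Cconj z)) as [w [H1 H2]]; [simpl; lra |].
    exists (Cconj w). split.
    + rewrite <- (Cconj_conj z). apply hyp_near_conj, H1.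
    + rewrite cexp_conj. simpl in *. lra.
Qed.

(** By contradiction: if every orbit from the disc avoids the axis, so does that of [z], and
    logarithms can be pulled back along it indefinitely. *)
Lemma eventually_real_dense (z : CC) (e : R) : 0 < e ->
  exists u n, cdist z u < e /\ snd (iter n cexp u) = 0.
Proof.
  intros He. apply NNPP. intros Hno.
  assert (Hnr : forall u n, cdist z u < e -> snd (iter n cexp u) <> 0).
  { intros u n Hu H. apply Hno. exists u, n. auto. }
  assert (Hzz : cdist z z < e).
  { change (Cmod (z - z)%C < e). replace (z - z)%C with (RtoC 0) by ring.
    rewrite Cmod_0. exact He. }
  set (o := fun n => iter n cexp z).
  assert (Ho : forall n, snd (o n) <> 0) by (intros n; apply Hnr, Hzz).
  destruct (hyp_near_dist e z He (Ho 0%nat)) as [q0 [Hq0 Hnear]].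
  (* [q] survives every step ([Hstep]) and is multiplied by [gain] at each visit away from the axis
     ([Hstep']). It is capped at 16, which is enough for [real_preimage_near] and keeps [gain * q]
     within the bound 32 of [log_branch]. *)
  set (covers := fun n q => forall w, hyp_near q (o n) w ->
    exists u, cdist z u < e /\ iter n cexp u = w).
  assert (Hmono : forall n q q', q' <= q -> covers n q -> covers n q').
  { intros n q q' Hq Hc w Hw. apply Hc, (hyp_near_mono q' q); assumption. }
  assert (Hstep : forall n q, covers n q -> covers (S n) q).
  { intros n q Hc W HW.
    destruct (log_branch (o n) W (Ho n)) as [w [Hw Hb]]; [apply HW |].
    destruct (Hb q HW) as [H1 _]. destruct (Hc w H1) as [u [Hu E]].
    exists u. split; [exact Hu |]. rewrite iter_S, E. exact Hw. }
  assert (Hgain : 1 < gain <= 2) by (unfold gain; lra).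
  assert (Hstep' : forall n q, 1 / 4 <= Rabs (snd (o n)) -> q <= 16 ->
    covers n q -> covers (S n) (gain * q)).
  { intros n q Hn Hq Hc W HW.
    destruct (log_branch (o n) W (Ho n)) as [w [Hw Hb]]; [apply HW |].
    destruct (Hb (gain * q) HW) as [_ H1].
    assert (Hq' : gain * q <= 32) by nra.
    specialize (H1 Hn Hq').
    replace (gain * q / gain) with q in H1 by (field; lra).
    destruct (Hc w H1) as [u [Hu E]].
    exists u. split; [exact Hu |]. rewrite iter_S, E. exact Hw. }
  assert (Hsteps : forall m n q, covers n q -> covers (m + n)%nat q).
  { induction m as [| m IH]; intros n q H; [exact H |]. apply Hstep, IH, H. }
  assert (Hret : forall n q, covers n q -> exists n', covers n' q /\
    1 / 4 <= Rabs (snd (o n'))).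
  { intros n q Hc. destruct (nonreal_orbit_leaves_axis z Ho n) as [n' [Hn' H]].
    exists n'. split; [| exact H].
    replace n' with ((n' - n) + n)%nat by lia. apply Hsteps, Hc. }
  assert (Hgrow : forall m, exists n, covers n (Rmin 16 (q0 * gain ^ m))).
  { induction m as [| m [n IH]].
    - exists 0%nat. apply (Hmono _ q0); [simpl; rewrite Rmult_1_r; apply Rmin_r |].
      intros w Hw. exists w. split; [apply Hnear, Hw | reflexivity].
    - destruct (Hret n _ IH) as [n' [Hc H]].
      exists (S n').
      apply (Hmono _ (gain * Rmin 16 (q0 * gain ^ m))).
      + simpl. unfold Rmin. repeat destruct Rle_dec; nra.
      + apply Hstep'; [exact H | apply Rmin_l | exact Hc]. }
  destruct (geometric_unbounded q0 gain 16) as [m Hm]; [lra | lra |].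
  destruct (Hgrow m) as [n Hc]. rewrite Rmin_left in Hc by lra.
  destruct (Hret n _ Hc) as [n' [Hc' H]].
  destruct (real_preimage_near (o n') H) as [w [Hw Hw0]].
  destruct (Hc' w Hw) as [u [Hu E]].
  apply (Hnr u (S n') Hu). rewrite iter_S, E. exact Hw0.
Qed.

(** * Euclidean discs and Lipschitz inverse branches *)

Definition cball (z : CC) (r : R) (w : CC) : Prop := cdist z w <= r.

Lemma cdist_sym (z w : CC) : cdist z w = cdist w z.
Proof. unfold cdist. f_equal. ring. Qed.

Lemma cdist_refl (z : CC) : cdist z z = 0.
Proof.
  change (Cmod (z - z)%C = 0). replace (z - z)%C with (RtoC 0) by ring. apply Cmod_0.
Qed.

Lemma cdist_triangle (z w u : CC) : cdist z u <= cdist z w + cdist w u.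
Proof.
  change (Cmod (z - u)%C <= Cmod (z - w)%C + Cmod (w - u)%C).
  replace (z - u)%C with ((z - w) + (w - u))%C by ring. apply Cmod_triangle.
Qed.

Lemma cdist_ge_0 (z w : CC) : 0 <= cdist z w.
Proof. exact (Cmod_ge_0 (z - w)%C). Qed.

Lemma cdist_le_sum (z w : CC) :
  cdist z w <= Rabs (fst z - fst w) + Rabs (snd z - snd w).
Proof.
  apply (Cmod_le_sqr (z - w)%C).
  - pose proof (Rabs_pos (fst z - fst w)). pose proof (Rabs_pos (snd z - snd w)). lra.
  - pose proof (Rabs_pos (fst z - fst w)). pose proof (Rabs_pos (snd z - snd w)).
    simpl fst; simpl snd. change (fst z + - fst w) with (fst z - fst w).
    change (snd z + - snd w) with (snd z - snd w).
    rewrite <- (pow2_abs (fst z - fst w)), <- (pow2_abs (snd z - snd w)). nra.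
Qed.

Lemma cdist_ge_fst (z w : CC) : Rabs (fst z - fst w) <= cdist z w.
Proof. eapply Rle_trans; [| apply (Rmax_Cmod (z - w)%C)]. apply Rmax_l. Qed.

Lemma cdist_ge_snd (z w : CC) : Rabs (snd z - snd w) <= cdist z w.
Proof. eapply Rle_trans; [| apply (Rmax_Cmod (z - w)%C)]. apply Rmax_r. Qed.

(** Principal logarithm of 1 + u where Re (1 + u) > 0: with t the slope of 1 + u, its modulus is (1
    + Re u) sqrt (1 + t^2) and its argument atan t. *)
Definition log1p (u : C) : C :=
  (ln ((1 + fst u) * sqrt (1 + (snd u / (1 + fst u))²)), atan (snd u / (1 + fst u))).

Lemma cexp_log1p (u : C) : Cmod u <= 1 / 4 ->
  cexp (log1p u) = (1 + u)%C /\ Rabs (snd (log1p u)) <= 1.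
Proof.
  intros Hu. pose proof (Rmax_Cmod u) as HM.
  assert (Ha : Rabs (fst u) <= 1 / 4) 
    by (eapply Rle_trans; [apply Rmax_l |]; eapply Rle_trans; eassumption).
  assert (Hb : Rabs (snd u) <= 1 / 4) 
    by (eapply Rle_trans; [apply Rmax_r |]; eapply Rle_trans; eassumption).
  destruct u as [a b]. simpl in Ha, Hb. apply Rabs_le_between in Ha, Hb.
  unfold log1p, cexp; simpl fst; simpl snd.
  set (t := b / (1 + a)).
  assert (Hbt : b = t * (1 + a)) by (unfold t; field; lra).
  assert (Ht : -1 < t < 1) by (split; nra).
  assert (Hs : 0 < sqrt (1 + t²)) by (apply sqrt_lt_R0; unfold Rsqr; nra).
  split.
  - rewrite exp_ln by (apply Rmult_lt_0_compat; lra).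
    rewrite cos_atan, sin_atan. unfold Cplus; simpl.
    f_equal; [field; lra |]. rewrite Rplus_0_l, Hbt at 1. field; lra.
  - pose proof (atan_increasing t 1 ltac:(lra)).
    pose proof (atan_increasing (Ropp 1) t ltac:(lra)) as H1.
    rewrite atan_opp in H1. rewrite atan_1 in *. pose proof PI_4.
    apply Rabs_le. lra.
Qed.

Lemma sin_sqr_ge (t : R) : Rabs t <= 1 -> t ^ 2 / 4 <= sin t ^ 2.
Proof.
  assert (Hpos : forall t, 0 <= t <= 1 -> t ^ 2 / 4 <= sin t ^ 2).
  { intros s Hs. pose proof (sin_cubic_bounds s ltac:(lra)).
    assert (s ^ 3 <= s) by nra. assert (s / 2 <= sin s) by lra. nra. }
  intros Ht. destruct (Rle_or_lt 0 t) as [H | H].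
  - rewrite Rabs_pos_eq in Ht by lra. apply Hpos; lra.
  - rewrite Rabs_left in Ht by lra. pose proof (Hpos (- t) ltac:(lra)) as H1.
    rewrite sin_neg in H1. nra.
Qed.

(** Apply [cexp_dist_sqr_ge] to the two logarithms: the moduli |1 + u|, |1 + v| are at least 3/4,
    and imaginary parts bounded by 1 make the sine comparable to its argument. *)
Lemma log1p_lipschitz (u v : C) : Cmod u <= 1 / 4 -> Cmod v <= 1 / 4 ->
  Cmod (log1p u - log1p v)%C <= 4 * Cmod (u - v)%C.
Proof.
  intros Hu Hv.
  assert (Hmod : forall u, Cmod u <= 1 / 4 -> 3 / 4 <= exp (fst (log1p u))).
  { intros w Hw. destruct (cexp_log1p w Hw) as [E _].
    rewrite <- Cmod_cexp, E. pose proof (Cmod_triangle (1 + w)%C (- w)%C) as H.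
    replace (1 + w + - w)%C with (RtoC 1) in H by ring.
    rewrite Cmod_1, Cmod_opp in H. lra. }
  destruct (cexp_log1p u Hu) as [Eu Bu]. destruct (cexp_log1p v Hv) as [Ev Bv].
  pose proof (Hmod u Hu) as Mu. pose proof (Hmod v Hv) as Mv.
  pose proof (cexp_dist_sqr_ge (log1p u) (log1p v)) as H.
  rewrite Eu, Ev in H. replace (1 + u - (1 + v))%C with (u - v)%C in H by ring.
  apply Cmod_le_sqr; [pose proof (Cmod_ge_0 (u - v)%C); lra |].
  set (p := log1p u) in *. set (r := log1p v) in *.
  rewrite exp_plus in H.
  assert (Hs : ((snd p - snd r) / 2) ^ 2 / 4 <= sin ((snd p - snd r) / 2) ^ 2).
  { apply sin_sqr_ge. apply Rabs_le_between in Bu, Bv. apply Rabs_le. lra. }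
  assert (1 / 4 <= exp (fst p) * exp (fst r)) by nra.
  assert (1 / 4 * ((fst p - fst r) ^ 2 + 4 * sin ((snd p - snd r) / 2) ^ 2)
    <= exp (fst p) * exp (fst r) * ((fst p - fst r) ^ 2 + 4 * sin ((snd p - snd r) / 2) ^ 2)).
  { apply Rmult_le_compat_r; [| assumption].
    pose proof (pow2_ge_0 (fst p - fst r)).
    pose proof (pow2_ge_0 (sin ((snd p - snd r) / 2))). lra. }
  pose proof (pow2_ge_0 (fst p - fst r)).
  replace ((4 * Cmod (u - v)%C) ^ 2) with (16 * Cmod (u - v)%C ^ 2) by ring.
  replace (((snd p - snd r) / 2) ^ 2 / 4) with ((snd p - snd r) ^ 2 / 16) in Hs by field.
  change (fst (p - r)%C) with (fst p - fst r).
  change (snd (p - r)%C) with (snd p - snd r).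
  set (d2 := (fst p - fst r) ^ 2) in *. set (b2 := (snd p - snd r) ^ 2) in *.
  set (s2 := sin ((snd p - snd r) / 2) ^ 2) in *.
  lra.
Qed.

(** Lipschitz constants stand in for derivatives: they multiply under composition, and [K < 1] on a
    disc mapped into itself gives a fixed point, which is periodic for the exponential if n >= 1. *)
Definition inverse_branch (n : nat) (K : R) (A B : CC -> Prop) : Prop :=
  exists g : CC -> CC,
    (forall w, B w -> A (g w) /\ iter n cexp (g w) = w) /\
    (forall w w', B w -> B w' -> cdist (g w) (g w') <= K * cdist w w').

Lemma inverse_branch_comp (n m : nat) (K L : R) (A B D : CC -> Prop) :
  0 <= K -> inverse_branch n K A B -> inverse_branch m L B D ->
  inverse_branch (m + n) (K * L) A D.
Proof.
  intros HK [g [Hg Lg]] [h [Hh Lh]]. exists (fun w => g (h w)). split.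
  - intros w Hw. destruct (Hh w Hw) as [H1 H2]. destruct (Hg _ H1) as [H3 H4].
    split; [exact H3 |]. rewrite iter_plus, H4. exact H2.
  - intros w w' Hw Hw'. destruct (Hh w Hw), (Hh w' Hw').
    eapply Rle_trans; [apply Lg; assumption |].
    rewrite Rmult_assoc. apply Rmult_le_compat_l; auto.
Qed.

Lemma inverse_branch_mono (n : nat) (K K' : R) (A A' B B' : CC -> Prop) :
  K <= K' -> (forall z, A z -> A' z) -> (forall z, B' z -> B z) ->
  inverse_branch n K A B -> inverse_branch n K' A' B'.
Proof.
  intros HK HA HB [g [Hg Lg]]. exists g. split.
  - intros w Hw. destruct (Hg w (HB w Hw)). auto.
  - intros w w' Hw Hw'. eapply Rle_trans; [apply Lg; auto |].
    apply Rmult_le_compat_r; [apply cdist_ge_0 | exact HK].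
Qed.

Lemma cball_sub (z z' : CC) (r r' : R) : cdist z z' + r <= r' ->
  forall w, cball z' r w -> cball z r' w.
Proof. unfold cball. intros H w Hw. pose proof (cdist_triangle z z' w). lra. Qed.

(** Write w = e^z (1 + u); the branch is z + log (1 + u). Here |u| <= r/4 <= 1/4, and the Lipschitz
    constant 4 brings the value back within [r] of [z]. *)
Lemma log_inverse_branch (z : CC) (r : R) : 0 < r <= 1 ->
  inverse_branch 1 (4 / exp (fst z)) (cball z r)
    (cball (cexp z) (r * exp (fst z) / 4)).
Proof.
  intros Hr. pose proof (exp_pos (fst z)) as He. pose proof (Cmod_cexp z) as Hm.
  assert (Hz : cexp z <> RtoC 0) by (apply Cmod_gt_0; rewrite Hm; exact He).
  set (m := exp (fst z)) in *.
  set (u := fun w : C => ((w - cexp z) / cexp z)%C).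
  assert (Hud : forall w w', Cmod (u w - u w')%C = cdist w w' / m).
  { intros w w'. rewrite <- Hm. unfold u.
    replace ((w - cexp z) / cexp z - (w' - cexp z) / cexp z)%C
      with ((w - w') / cexp z)%C by (field; exact Hz).
    rewrite Cmod_div by exact Hz. reflexivity. }
  assert (Hu : forall w, cball (cexp z) (r * m / 4) w -> Cmod (u w) <= r / 4).
  { intros w Hw. unfold cball in Hw. rewrite cdist_sym in Hw.
    unfold u. rewrite Cmod_div by exact Hz.
    change (cdist w (cexp z) / Cmod (cexp z) <= r / 4). rewrite Hm.
    apply (Rmult_le_reg_r m); [exact He |].
    replace (cdist w (cexp z) / m * m) with (cdist w (cexp z)) by (field; lra). lra. }
  assert (Hshift : forall p q : C, Cmod ((z + p) - (z + q))%C = Cmod (p - q)%C).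
  { intros p q. f_equal. ring. }
  exists (fun w => (z + log1p (u w))%C). split.
  - intros w Hw. specialize (Hu w Hw). split.
    + unfold cball. rewrite cdist_sym.
      change (Cmod ((z + log1p (u w)) - z)%C <= r).
      replace ((z + log1p (u w)) - z)%C with (log1p (u w) - log1p 0)%C.
      * eapply Rle_trans; [apply log1p_lipschitz; [lra | rewrite Cmod_0; lra] |].
        replace (u w - 0)%C with (u w) by ring. lra.
      * replace (log1p 0) with (RtoC 0); [ring |].
        unfold log1p, RtoC; simpl. unfold Rdiv. rewrite Rmult_0_l, atan_0.
        unfold Rsqr. rewrite Rmult_0_l, !Rplus_0_r, sqrt_1, Rmult_1_l, ln_1. reflexivity.
    + change (cexp (z + log1p (u w))%C = w). rewrite cexp_plus.
      destruct (cexp_log1p (u w)) as [E _]; [lra |]. rewrite E. unfold u.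
      assert (F : forall a b : C, b <> RtoC 0 -> (b * (1 + (a - b) / b))%C = a)
        by (intros; field; assumption).
      apply F, Hz.
  - intros w w' Hw Hw'.
    change (Cmod ((z + log1p (u w)) - (z + log1p (u w')))%C <= 4 / m * cdist w w').
    rewrite Hshift.
    eapply Rle_trans; [apply log1p_lipschitz |].
    + pose proof (Hu w Hw). lra.
    + pose proof (Hu w' Hw'). lra.
    + rewrite Hud. apply Req_le. field. lra.
Qed.

(** Merely transports the disc to a time when the orbit is real and large; [r] and [K] are improved
    only from there on. *)
Lemma inverse_branch_orbit (u : CC) (e : R) (j : nat) : 0 < e ->
  exists r K, 0 < r /\ 0 < K /\
    inverse_branch j K (cball u e) (cball (iter j cexp u) r).
Proof.
  intros He. induction j as [| j [r [K [Hr [HK IH]]]]].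
  - exists e, 1. repeat split; try lra. exists (fun w => w). split.
    + intros w Hw. split; [exact Hw | reflexivity].
    + intros. lra.
  - set (z := iter j cexp u) in *. pose proof (exp_pos (fst z)).
    assert (H1 : 0 < Rmin r 1) by (apply Rmin_pos; lra).
    exists (Rmin r 1 * exp (fst z) / 4), (K * (4 / exp (fst z))).
    repeat split.
    + apply Rdiv_lt_0_compat; [apply Rmult_lt_0_compat; lra | lra].
    + apply Rmult_lt_0_compat; [lra | apply Rdiv_lt_0_compat; lra].
    + change (S j) with (1 + j)%nat.
      apply inverse_branch_comp with (B := cball z (Rmin r 1)); [lra | |].
      * revert IH. apply inverse_branch_mono; auto with real.
        apply cball_sub. rewrite cdist_refl. pose proof (Rmin_l r 1). lra.
      * rewrite iter_plus. apply log_inverse_branch.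
        pose proof (Rmin_r r 1). lra.
Qed.

(** * Real orbits, large discs and arbitrary targets *)

Lemma real_orbit_escapes (u : CC) (n : nat) (c : R) :
  snd (iter n cexp u) = 0 ->
  exists N, forall j, (N <= j)%nat ->
    snd (iter j cexp u) = 0 /\ c <= fst (iter j cexp u).
Proof.
  intros Hn.
  assert (H : forall m, snd (iter (n + m) cexp u) = 0 /\
    fst (iter n cexp u) + INR m <= fst (iter (n + m) cexp u)).
  { induction m as [| m [IH1 IH2]].
    - rewrite Nat.add_0_r. simpl INR. lra.
    - rewrite Nat.add_succ_r, iter_S, S_INR. set (w := iter (n + m) cexp u) in *.
      unfold cexp at 1 3; cbn [fst snd].
      rewrite IH1, sin_0, cos_0. pose proof (exp_ineq1_le (fst w)). lra. }
  destruct (INR_unbounded (c - fst (iter n cexp u))) as [M HM].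
  exists (n + M)%nat. intros j Hj. replace j with (n + (j - n))%nat by lia.
  destruct (H (j - n)%nat) as [H1 H2]. split; [exact H1 |].
  assert (INR M <= INR (j - n)) by (apply le_INR; lia). lra.
Qed.

(** Once the orbit is real and at least 8, each step doubles the radius, up to 1, and halves the
    Lipschitz constant, since exp / 4 >= 2. A unit disc then covers the disc of radius X/4 about its
    image X. *)
Lemma inverse_branch_large_ball (u : CC) (e : R) (n : nat) (c K0 : R) :
  0 < e -> 0 < K0 -> snd (iter n cexp u) = 0 ->
  exists j X K, c <= X /\ 0 <= K <= K0 /\
    inverse_branch j K (cball u e) (cball (X, 0) (X / 4)).
Proof.
  intros He HK0 Hn.
  destruct (real_orbit_escapes u n (Rmax c 8) Hn) as [N HN].
  pose proof (Rmax_l c 8). pose proof (Rmax_r c 8).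
  destruct (inverse_branch_orbit u e N He) as [r [K [Hr [HK HB]]]].
  set (p := fun j => iter j cexp u) in *.
  assert (Hp : forall j, (N <= j)%nat -> 8 <= exp (fst (p j)) /\
    p (S j) = (exp (fst (p j)), 0)).
  { intros j Hj. destruct (HN j Hj) as [H1 H2].
    change (p (S j)) with (cexp (p j)). unfold cexp.
    change (snd (p j) = 0) in H1. change (Rmax c 8 <= fst (p j)) in H2.
    rewrite H1, cos_0, sin_0, Rmult_0_r, Rmult_1_r.
    pose proof (exp_ineq1_le (fst (p j))). split; [lra | reflexivity]. }
  assert (Hind : forall m, inverse_branch (m + N) (K / 2 ^ m) (cball u e)
    (cball (p (m + N)%nat) (Rmin 1 (r * 2 ^ m)))).
  { induction m as [| m IH].
    - revert HB. simpl. apply inverse_branch_mono; [lra | auto |].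
      apply cball_sub. unfold p. rewrite cdist_refl. pose proof (Rmin_r 1 (r * 1)). lra.
    - destruct (Hp (m + N)%nat ltac:(lia)) as [H8 _].
      assert (H2 : 0 < 2 ^ m) by (apply pow_lt; lra).
      assert (Hmin : 0 < Rmin 1 (r * 2 ^ m)) by (apply Rmin_pos; nra).
      pose proof (log_inverse_branch (p (m + N)%nat) (Rmin 1 (r * 2 ^ m))
        (conj Hmin (Rmin_l _ _))) as HL.
      assert (HK2 : 0 < K / 2 ^ m) by (apply Rdiv_lt_0_compat; lra).
      assert (HK3 := inverse_branch_comp _ _ _ _ _ _ _ (Rlt_le _ _ HK2) IH HL).
      revert HK3. apply inverse_branch_mono; [| auto |].
      + replace (K / 2 ^ S m) with (K / 2 ^ m * (1 / 2)) by (simpl; field; lra).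
        apply Rmult_le_compat_l; [lra |].
        apply (Rmult_le_reg_r (exp (fst (p (m + N)%nat)))); [lra |].
        unfold Rdiv. rewrite Rmult_assoc, Rinv_l; lra.
      + apply cball_sub. change (p (S m + N)%nat) with (cexp (p (m + N)%nat)).
        rewrite cdist_refl, Rplus_0_l.
        apply Rle_trans with (2 * Rmin 1 (r * 2 ^ m)).
        * simpl pow. unfold Rmin. repeat destruct Rle_dec; nra.
        * nra. }
  (* [m1] steps bring the radius to 1, [m2] steps the constant below [K0]; their sum achieves
     both. *)
  destruct (geometric_unbounded r 2 1) as [m1 Hm1]; [lra | lra |].
  destruct (geometric_unbounded K0 2 K) as [m2 Hm2]; [lra | lra |].
  set (m := (m1 + m2)%nat).
  assert (P1 : 1 <= 2 ^ m1) by (apply pow_R1_Rle; lra).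
  assert (P2 : 1 <= 2 ^ m2) by (apply pow_R1_Rle; lra).
  assert (Hm : 2 ^ m = 2 ^ m1 * 2 ^ m2) by apply pow_add.
  assert (Hr1 : 1 <= r * 2 ^ m).
  { rewrite Hm. apply Rle_trans with (r * 2 ^ m1); [lra |].
    rewrite <- Rmult_assoc. assert (0 < r * 2 ^ m1) by lra. nra. }
  assert (HKm : 0 < K / 2 ^ m <= K0).
  { split; [apply Rdiv_lt_0_compat; nra |].
    apply (Rmult_le_reg_r (2 ^ m)); [nra |].
    replace (K / 2 ^ m * 2 ^ m) with K by (field; nra).
    rewrite Hm. apply Rle_trans with (K0 * 2 ^ m2); [lra |].
    assert (0 < K0 * 2 ^ m2) by lra. nra. }
  specialize (Hind m). rewrite Rmin_left in Hind by exact Hr1.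
  destruct (Hp (m + N)%nat ltac:(lia)) as [H8 HS].
  set (X := exp (fst (p (m + N)%nat))) in *.
  exists (1 + (m + N))%nat, X, (K / 2 ^ m * (4 / X)).
  assert (H4 : 0 < 4 / X <= 1 / 2).
  { split; [apply Rdiv_lt_0_compat; lra |].
    apply (Rmult_le_reg_r X); [lra |]. unfold Rdiv. rewrite Rmult_assoc, Rinv_l; lra. }
  split; [| split].
  - destruct (HN (S (m + N)) ltac:(lia)) as [_ H2].
    change (Rmax c 8 <= fst (p (S (m + N)))) in H2. rewrite HS in H2. simpl in H2. lra.
  - nra.
  - apply inverse_branch_comp with (B := cball (p (m + N)%nat) 1); [lra | exact Hind |].
    rewrite <- HS. replace (X / 4) with (1 * X / 4) by field.
    apply log_inverse_branch. lra.
Qed.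

Lemma exp_le_inv (x y : R) : exp x <= exp y -> x <= y.
Proof.
  intros H. apply Rnot_lt_le. intros H1. apply exp_increasing in H1. lra.
Qed.

(* A preimage [zeta] of [v] with imaginary part close to [exp X] has itself
   a preimage close to [X]. *)
Lemma inverse_branch_target (v : C) : v <> RtoC 0 ->
  exists X0, forall X, X0 <= X ->
    inverse_branch 2 (4 / Cmod v) (cball (X, 0) (X / 4)) (cball v (Cmod v / 4)).
Proof.
  intros Hv. destruct (polar v Hv) as [[a th] [Ez Hth]]. simpl in Hth.
  pose proof PI_RGT_0 as HPI. pose proof PI_4 as HPI4.
  assert (Hv0 : 0 < Cmod v) by (apply Cmod_gt_0, Hv).
  (* 40 leaves room for X/4 >= 5 + 1 and makes exp X dominate |a| and the multiples of PI. *)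
  exists (Rabs a + 40). intros X HX. pose proof (Rabs_pos a) as Ha.
  pose proof (exp_ineq1_le X) as HeX. pose proof (exp_pos X).
  destruct (nfloor_ex (exp X / (2 * PI))) as [k Hk]; [apply Rdiv_le_0_compat; lra |].
  assert (Ek : exp X / (2 * PI) * (2 * PI) = exp X) by (field; lra).
  (* The argument of [v], shifted by full turns to within 3 PI of exp X, so that a logarithm of
     [zeta] lies near X. *)
  set (Y := th + 2 * INR k * PI).
  assert (HY : exp X - 3 * PI <= Y <= exp X + PI) by (unfold Y; split; nra).
  set (zeta := (a, Y) : C).
  assert (Ezeta : cexp zeta = v).
  { rewrite <- Ez. unfold zeta, Y, cexp; cbn [fst snd].
    rewrite sin_period, cos_period. reflexivity. }
  set (m := Cmod zeta).
  assert (Hm : exp X / 2 <= m <= 2 * exp X).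
  { split.
    - pose proof (Rmax_Cmod zeta) as H1. pose proof (Rmax_r (Rabs a) (Rabs Y)) as H2.
      pose proof (Rle_abs Y). unfold zeta in H1; simpl in H1. fold zeta in H1. fold m in H1. lra.
    - pose proof (cdist_le_sum zeta (RtoC 0)) as H1.
      change (cdist zeta (RtoC 0)) with (Cmod (zeta - 0)%C) in H1.
      replace (zeta - 0)%C with zeta in H1 by ring. fold m in H1.
      unfold zeta in H1; simpl in H1. rewrite !Rminus_0_r, (Rabs_pos_eq Y) in H1 by lra. lra. }
  assert (Hm0 : 0 < m) by lra.
  destruct (polar zeta) as [xi [Exi Hxi]]; [apply Cmod_gt_0; exact Hm0 |].
  assert (Emod : exp (fst xi) = m) by (rewrite <- Cmod_cexp, Exi; reflexivity).
  pose proof (exp_ineq1_le 1) as He1.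
  assert (Hfst : X - 1 <= fst xi <= X + 1).
  (* [m] is within a factor 2 of exp X, and 2 <= e. *)
  { split; apply exp_le_inv; rewrite Emod.
    - replace (exp X) with (exp (X - 1) * exp 1) in Hm
        by (rewrite <- exp_plus; f_equal; ring).
      pose proof (exp_pos (X - 1)). nra.
    - rewrite exp_plus. nra. }
  assert (Hdist : cdist (X, 0) xi <= 5).
  { eapply Rle_trans; [apply cdist_le_sum |]. cbn [fst snd].
    assert (Rabs (X - fst xi) <= 1) by (apply Rabs_le; lra).
    assert (Rabs (0 - snd xi) <= 4) by (apply Rabs_le; lra). lra. }
  pose proof (log_inverse_branch xi 1 ltac:(lra)) as B1.
  pose proof (log_inverse_branch zeta 1 ltac:(lra)) as B2.
  rewrite Exi, Emod in B1. rewrite Ezeta in B2.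
  rewrite <- (Cmod_cexp zeta), Ezeta in B2.
  apply inverse_branch_mono with (K' := 1) (A' := cball (X, 0) (X / 4))
    (B' := cball zeta 1) in B1.
  - replace (4 / Cmod v) with (1 * (4 / Cmod v)) by ring.
    replace (Cmod v / 4) with (1 * Cmod v / 4) by field.
    apply (inverse_branch_comp 1 1 1 _ _ _ _ Rle_0_1 B1 B2).
  - apply (Rmult_le_reg_r m); [lra |]. unfold Rdiv. rewrite Rmult_assoc, Rinv_l; lra.
  - apply cball_sub. lra.
  - apply cball_sub. rewrite cdist_refl. lra.
Qed.

(** Chain: the disc at [z] contains one at an eventually real [u], which covers a large disc, which
    covers the disc at [v]. The last constant 4/|v| is known beforehand, so |v|/8 is demanded of the
    earlier one and the product is at most 1/2. *)
Lemma inverse_branch_anywhere (z : CC) (e : R) (v : C) : 0 < e -> v <> RtoC 0 ->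
  exists n K, (1 <= n)%nat /\ 0 <= K < 1 /\
    inverse_branch n K (cball z e) (cball v (Cmod v / 4)).
Proof.
  intros He Hv.
  destruct (eventually_real_dense z (e / 2) ltac:(lra)) as [u [n [Hu Hn]]].
  destruct (inverse_branch_target v Hv) as [X0 HX0].
  assert (Hv0 : 0 < Cmod v) by (apply Cmod_gt_0, Hv).
  destruct (inverse_branch_large_ball u (e / 2) n X0 (Cmod v / 8))
    as [j [X [K [HX [HK HB]]]]]; [lra | lra | exact Hn |].
  exists (2 + j)%nat, (K * (4 / Cmod v)). split; [lia |]. split.
  - assert (H4 : 0 < 4 / Cmod v) by (apply Rdiv_lt_0_compat; lra). split; [nra |].
    apply Rle_lt_trans with (Cmod v / 8 * (4 / Cmod v)).
    + apply Rmult_le_compat_r; lra.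
    + replace (Cmod v / 8 * (4 / Cmod v)) with (1 / 2) by (field; lra). lra.
  - apply inverse_branch_comp with (B := cball (X, 0) (X / 4)); [lra | | apply HX0, HX].
    revert HB. apply inverse_branch_mono; [lra | | auto]. apply cball_sub. lra.
Qed.

(** * Banach fixed point theorem on a closed disc *)

Lemma banach_cball (g : CC -> CC) (c : CC) (r K : R) : 0 <= K < 1 ->
  (forall w, cball c r w -> cball c r (g w)) ->
  (forall w w', cball c r w -> cball c r w' -> cdist (g w) (g w') <= K * cdist w w') ->
  0 <= r -> exists l, cball c r l /\ g l = l.
Proof.
  intros HK Hg Lg Hr.
  set (x := fun n => Nat.iter n g c).
  assert (Hx : forall n, cball c r (x n)).
  { induction n; [unfold cball, x; simpl; rewrite cdist_refl; exact Hr | apply Hg, IHn]. }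
  (* Starting at the centre, every iterate is within [r] of [x 0]; applying [g] n times scales this
     bound by [K ^ n]. *)
  assert (Hxx : forall n m, cdist (x n) (x (n + m)%nat) <= K ^ n * r).
  { induction n as [| n IH]; intros m.
    - simpl. rewrite Rmult_1_l. apply Hx.
    - simpl. eapply Rle_trans; [apply Lg; apply Hx |].
      rewrite Rmult_assoc. apply Rmult_le_compat_l; [lra | apply IH]. }
  assert (Hsmall : forall e, 0 < e -> exists N, forall n, (N <= n)%nat -> K ^ n * r < e).
  (* Dividing by [r + 1] covers the case r = 0. *)
  { intros e He. destruct (pow_lt_1_zero K) with (y := e / (r + 1)) as [N HN].
    - rewrite Rabs_pos_eq; lra.
    - apply Rdiv_lt_0_compat; lra.
    - exists N. intros n Hn. specialize (HN n Hn).
      rewrite Rabs_pos_eq in HN by (apply pow_le; lra).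
      apply Rle_lt_trans with (K ^ n * (r + 1)).
      + apply Rmult_le_compat_l; [apply pow_le; lra | lra].
      + replace e with (e / (r + 1) * (r + 1)) by (field; lra).
        apply Rmult_lt_compat_r; lra. }
  assert (Hcauchy : forall p : CC -> R,
    (forall z w, Rabs (p z - p w) <= cdist z w) -> exists a, Un_cv (fun n => p (x n)) a).
  { intros p Hp. destruct (Rcomplete.R_complete (fun n => p (x n))) as [a Ha]; [| exists a; exact Ha].
    intros e He. destruct (Hsmall (e / 2) ltac:(lra)) as [N HN]. exists N.
    assert (H : forall n, (N <= n)%nat -> cdist (x N) (x n) < e / 2).
    { intros n Hn. replace n with (N + (n - N))%nat by lia.
      eapply Rle_lt_trans; [apply Hxx | apply HN; lia]. }
    intros n m Hn Hm. unfold Rdist.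
    eapply Rle_lt_trans; [apply Hp |].
    pose proof (cdist_triangle (x n) (x N) (x m)). rewrite (cdist_sym (x n) (x N)) in H0.
    pose proof (H n Hn). pose proof (H m Hm). lra. }
  destruct (Hcauchy fst cdist_ge_fst) as [a Ha].
  destruct (Hcauchy snd cdist_ge_snd) as [b Hb].
  set (l := (a, b) : CC).
  assert (Hl : forall e, 0 < e -> exists N, forall n, (N <= n)%nat -> cdist (x n) l < e).
  { intros e He. destruct (Ha (e / 2) ltac:(lra)) as [N1 H1].
    destruct (Hb (e / 2) ltac:(lra)) as [N2 H2].
    exists (N1 + N2)%nat. intros n Hn.
    specialize (H1 n ltac:(lia)). specialize (H2 n ltac:(lia)). unfold Rdist in *.
    pose proof (cdist_le_sum (x n) l). unfold l in *; cbn [fst snd] in *. lra. }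
  assert (Hball : cball c r l).
  { apply le_epsilon. intros e He.
    destruct (Hl e He) as [N HN]. specialize (HN N (le_n N)).
    pose proof (cdist_triangle c (x N) l). pose proof (Hx N). unfold cball in *. lra. }
  exists l. split; [exact Hball |].
  assert (H0 : cdist (g l) l = 0).
  { apply Rle_antisym; [| apply cdist_ge_0].
    apply le_epsilon. intros e He.
    destruct (Hl (e / 2) ltac:(lra)) as [N HN].
    pose proof (HN N (le_n N)). pose proof (HN (S N) (le_S _ _ (le_n N))).
    pose proof (Lg l (x N) Hball (Hx N)) as H2.
    change (g (x N)) with (x (S N)) in H2.
    pose proof (cdist_triangle (g l) (x (S N)) l).
    rewrite (cdist_sym l) in H2. pose proof (cdist_ge_0 (x N) l). nra. }
  pose proof (Cmod_eq_0 (g l - l)%C H0) as E.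
  assert (F : forall p q : C, (p - q)%C = RtoC 0 -> p = q)
    by (intros p q H; replace p with ((p - q) + q)%C by ring; rewrite H; ring).
  apply F, E.
Qed.

(** * Continuity, infinitude and the conclusion *)

(** The exponential omits 0, so targets have to be moved off 0. *)
Lemma nonzero_nearby (U : CC -> Prop) (z : CC) : copen U -> U z ->
  exists w, U w /\ w <> RtoC 0.
Proof.
  intros HU Hz. destruct (classic (z = RtoC 0)) as [-> | H]; [| exists z; auto].
  destruct (HU _ Hz) as [e [He H]]. exists (RtoC (e / 2)). split.
  - apply H. rewrite cdist_sym. change (Cmod (RtoC (e / 2) - 0)%C < e).
    replace (RtoC (e / 2) - 0)%C with (RtoC (e / 2)) by ring.
    rewrite Cmod_R, Rabs_pos_eq; lra.
  - intros E. injection E. lra.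
Qed.

(** By [cexp_dist_sqr] the squared distance has a radial and an angular term; each is made at most
    (e/4)^2. *)
Lemma cexp_continuous (z : CC) (e : R) : 0 < e ->
  exists d, 0 < d /\ forall w, cdist z w < d -> cdist (cexp z) (cexp w) < e.
Proof.
  intros He.
  destruct (derivable_continuous_pt exp (fst z) (derivable_pt_exp (fst z)) (Rmin 1 (e / 4)))
    as [d1 [Hd1 H1]]; [apply Rmin_pos; lra |].
  pose proof (exp_pos (fst z)) as Hz.
  assert (Hq : 0 < Rmin 1 (e / (4 * (exp (fst z) + 1))))
    by (apply Rmin_pos; [| apply Rdiv_lt_0_compat]; lra).
  exists (Rmin d1 (Rmin 1 (e / (4 * (exp (fst z) + 1))))). split; [apply Rmin_pos; lra |].
  intros w Hw.
  pose proof (Rmin_l d1 (Rmin 1 (e / (4 * (exp (fst z) + 1))))) as M1.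
  pose proof (Rmin_r d1 (Rmin 1 (e / (4 * (exp (fst z) + 1))))) as M2.
  pose proof (Rmin_l 1 (e / (4 * (exp (fst z) + 1)))) as M3.
  pose proof (Rmin_r 1 (e / (4 * (exp (fst z) + 1)))) as M4.
  pose proof (cdist_ge_fst z w) as D1. pose proof (cdist_ge_snd z w) as D2.
  assert (Hexp : Rabs (exp (fst z) - exp (fst w)) < Rmin 1 (e / 4)).
  (* Equal real parts are treated apart, since [H1] concerns only points different from [fst z]. *)
  { destruct (Req_dec (fst w) (fst z)) as [-> | Hne].
    - rewrite Rminus_diag, Rabs_R0. apply Rmin_pos; lra.
    - rewrite Rabs_minus_sym. apply H1. split.
      + split; [exact I | auto].
      + simpl. unfold Rdist. rewrite Rabs_minus_sym. lra. }
  pose proof (Rmin_l 1 (e / 4)). pose proof (Rmin_r 1 (e / 4)).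
  set (b := snd z - snd w) in *.
  assert (Hb : Rabs b < e / (4 * (exp (fst z) + 1))) by lra.
  assert (Hs : sin (b / 2) ^ 2 <= (b / 2) ^ 2).
  { assert (H2 : Rabs b < 1) by lra. apply Rabs_lt_between in H2.
    apply sin_sqr_le, Rabs_le. lra. }
  pose proof (cexp_dist_sqr z w) as E. fold b in E. rewrite exp_plus in E.
  change (Cmod (cexp z - cexp w)%C) with (cdist (cexp z) (cexp w)) in E.
  assert (Hw1 : exp (fst w) <= exp (fst z) + 1).
  { pose proof (Rle_abs (- (exp (fst z) - exp (fst w)))) as H2.
    rewrite Rabs_Ropp in H2. lra. }
  assert (Hmul : (exp (fst z) + 1) * Rabs b < e / 4).
  { replace (e / 4) with ((exp (fst z) + 1) * (e / (4 * (exp (fst z) + 1)))) by (field; lra).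
    apply Rmult_lt_compat_l; lra. }
  assert (T1 : (exp (fst z) - exp (fst w)) ^ 2 <= (e / 4) ^ 2).
  { rewrite <- pow2_abs. apply pow_incr. split; [apply Rabs_pos | lra]. }
  assert (T2 : 4 * (exp (fst z) * exp (fst w)) * sin (b / 2) ^ 2 <= (e / 4) ^ 2).
  { apply Rle_trans with (((exp (fst z) + 1) * Rabs b) ^ 2).
    - replace (((exp (fst z) + 1) * Rabs b) ^ 2)
        with ((exp (fst z) + 1) * (exp (fst z) + 1) * (4 * (b / 2) ^ 2))
        by (rewrite Rpow_mult_distr, pow2_abs; field).
      pose proof (exp_pos (fst w)). pose proof (pow2_ge_0 (sin (b / 2))).
      replace (4 * (exp (fst z) * exp (fst w)) * sin (b / 2) ^ 2)
        with (exp (fst z) * exp (fst w) * (4 * sin (b / 2) ^ 2)) by ring.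
      apply Rmult_le_compat; try nra.
    - apply pow_incr. split; [| lra]. apply Rmult_le_pos; [lra | apply Rabs_pos]. }
  pose proof (cdist_ge_0 (cexp z) (cexp w)). nra.
Qed.

Lemma plane_infinite : infinite_set (fun _ : CC => True).
Proof.
  intros [l Hl].
  assert (H : forall l : list CC, exists b, forall z, List.In z l -> fst z < b).
  { induction l0 as [| z l' [b Hb]]; [exists 0; intros z [] |].
    exists (Rmax b (fst z + 1)). intros w [-> | Hw].
    - pose proof (Rmax_r b (fst w + 1)). lra.
    - pose proof (Rmax_l b (fst z + 1)). specialize (Hb w Hw). lra. }
  destruct (H l) as [b Hb]. specialize (Hb (b, 0) (Hl (b, 0) I)). simpl in Hb. lra.
Qed.

Theorem mainTheorem2 : devaney_chaotic (fun _ : CC => True) cexp.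
Proof.
  split; [exact plane_infinite |]. split; [intros z _; exact I |].
  split; [| split].
  - intros z _ e He. destruct (cexp_continuous z e He) as [d [Hd H]].
    exists d. split; [exact Hd | intros w _; apply H].
  - intros U HU [z0 [Hz0 _]].
    destruct (nonzero_nearby U z0 HU Hz0) as [z [Hz Hnz]].
    destruct (HU z Hz) as [e [He HeU]].
    assert (Hm : 0 < Cmod z) by (apply Cmod_gt_0, Hnz).
    (* |z|/4 is the radius on which the branch with target [z] is defined, so this branch maps the
       disc of radius [r] into itself; e/2 keeps the closed disc inside [U]. *)
    set (r := Rmin (e / 2) (Cmod z / 4)).
    assert (Hr : 0 < r) by (apply Rmin_pos; lra).
    pose proof (Rmin_l (e / 2) (Cmod z / 4)) as R1. fold r in R1.
    pose proof (Rmin_r (e / 2) (Cmod z / 4)) as R2. fold r in R2.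
    destruct (inverse_branch_anywhere z r z Hr Hnz) as [n [K [Hn [HK HB]]]].
    apply inverse_branch_mono with (K' := K) (A' := cball z r) (B' := cball z r) in HB;
      [| lra | auto | apply cball_sub; rewrite cdist_refl; lra].
    destruct HB as [g [Hg Lg]].
    destruct (banach_cball g z r K HK) as [l [Hl El]];
      [intros w Hw; apply Hg, Hw | exact Lg | lra |].
    exists l. split; [apply HeU; unfold cball in Hl; lra |]. split; [exact I |].
    (* A fixed point of the inverse branch is a fixed point of the n-th iterate. *)
    exists n. split; [exact Hn |]. destruct (Hg l Hl) as [_ H]. rewrite El in H. exact H.
  - intros U V HU HV [z [Hz _]] [v0 [Hv0 _]].
    destruct (nonzero_nearby V v0 HV Hv0) as [v [Hv Hnv]].
    destruct (HU z Hz) as [e [He HeU]].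
    destruct (inverse_branch_anywhere z (e / 2) v ltac:(lra) Hnv)
      as [n [K [_ [_ [g [Hg _]]]]]].
    destruct (Hg v) as [H1 H2].
    { unfold cball. rewrite cdist_refl. pose proof (Cmod_ge_0 v). lra. }
    exists (g v), n. split; [apply HeU; unfold cball in H1; lra |].
    split; [exact I |]. rewrite H2. exact Hv.
Qed.
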